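(* In the setting of the context, $A^*$ is $Q$-polynomial (i.e. $\Delta$ is a path) if and only if all of the following hold: (i) $\Delta$ has a leaf, i.e. some vertex of $\Delta$ is adjacent to at most one other vertex; (ii) there exist $\beta,\gamma^*\in\mathbb F$ such that $\gamma^*=\theta^*_{i-1}-\beta\theta^*_i+\theta^*_{i+1}$ for $1\le i\le d-1$; (iii) with $\beta,\gamma^*$ as in (ii) and with $\theta^*_{-1}:=\gamma^*+\beta\theta^*_0-\theta^*_1$ and $\theta^*_{d+1}:=\gamma^*+\beta\theta^*_d-\theta^*_{d-1}$ (so that the relation in (ii) also holds for $i=0$ and $i=d$), there exist $\gamma,\omega,\eta^*\in\mathbb F$ such that $$a_i(\theta^*_i-\theta^*_{i-1})(\theta^*_i-\theta^*_{i+1})=\gamma\theta^{*2}_i+\omega\theta^*_i+\eta^*\qquad(0\le i\le d);$$ (iv) $\theta^*_i\ne\theta^*_0$ for $1\le i\le d$.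
   Context: Let $\mathbb F$ be a field, $d\ge1$ an integer, $V$ a vector space over $\mathbb F$ of dimension $d+1$, $\mathcal A=\mathrm{End}(V)$ with identity $I$. Let $E^*_0,\dots,E^*_d\in\mathcal A$ satisfy $E^*_iE^*_j=\delta_{i,j}E^*_i$ and $\mathrm{rank}(E^*_i)=1$ for $0\le i,j\le d$. Let $A\in\mathcal A$ satisfy $E^*_iAE^*_j=0$ if $|i-j|>1$ and $E^*_iAE^*_j\neq0$ if $|i-j|=1$. Assume $A$ is multiplicity-free, i.e. has $d+1$ mutually distinct eigenvalues $\theta_0,\dots,\theta_d$ in $\mathbb F$, and let $E_i=\prod_{j\ne i}\frac{A-\theta_jI}{\theta_i-\theta_j}$ be the primitive idempotent of $A$ for $\theta_i$. Let $\theta^*_0,\dots,\theta^*_d\in\mathbb F$ and $A^*=\sum_{i=0}^d\theta^*_iE^*_i$. Define $a_i=\mathrm{tr}(E^*_iA)$ for $0\le i\le d$. Let $\Delta$ be the graph on vertex set $\{0,1,\dots,d\}$ in which $i,j$ are adjacent iff $i\ne j$ and $E_iA^*E_j\neq0$ (this relation is symmetric). $A^*$ is called $Q$-polynomial when $\Delta$ is a path graph (its vertices can be ordered $x_0,\dots,x_d$ so that the edges are exactly $\{x_{k-1},x_k\}$, $1\le k\le d$). *)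

(* Defs.v *)
(* End(V) with dim V = d+1 is modelled as 'M[F]_(d.+1). *)
From HB Require Import structures.
From mathcomp Require Import all_boot all_order all_algebra.
Set Implicit Arguments. Unset Strict Implicit. Unset Printing Implicit Defensive.
Import Order.TTheory GRing.Theory Num.Theory.
Local Open Scope ring_scope.

Definition prim_idem (F : fieldType) (d : nat) (A : 'M[F]_(d.+1))
  (th : 'I_(d.+1) -> F) (i : 'I_(d.+1)) : 'M[F]_(d.+1) :=
  \prod_(j < d.+1 | j != i) ((th i - th j)^-1 *: (A - (th j)%:M)).

Definition dual_op (F : fieldType) (d : nat) (Es : 'I_(d.+1) -> 'M[F]_(d.+1))
  (ths : 'I_(d.+1) -> F) : 'M[F]_(d.+1) :=
  \sum_(i < d.+1) ths i *: Es i.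

Definition Delta_adj (F : fieldType) (d : nat) (E : 'I_(d.+1) -> 'M[F]_(d.+1))
  (As : 'M[F]_(d.+1)) (i j : 'I_(d.+1)) : bool :=
  (i != j) && (E i *m As *m E j != 0).

Definition is_path_graph (d : nat) (adj : 'I_(d.+1) -> 'I_(d.+1) -> bool) : Prop :=
  exists x : 'I_(d.+1) -> 'I_(d.+1),
    bijective x /\
    forall a b : 'I_(d.+1), adj (x a) (x b) = ((a.+1 == b)%N || (b.+1 == a)%N).

Definition has_leaf (d : nat) (adj : 'I_(d.+1) -> 'I_(d.+1) -> bool) : Prop :=
  exists v : 'I_(d.+1), (#|[set w | adj v w]| <= 1)%N.

Definition ths_prev (F : fieldType) (d : nat) (ths : 'I_(d.+1) -> F)
  (beta gammas : F) (i : 'I_(d.+1)) : F :=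
  if (i == 0%N :> nat) then gammas + beta * ths (inord 0) - ths (inord 1)
  else ths (inord i.-1).

Definition ths_next (F : fieldType) (d : nat) (ths : 'I_(d.+1) -> F)
  (beta gammas : F) (i : 'I_(d.+1)) : F :=
  if (i == d :> nat) then gammas + beta * ths (inord d) - ths (inord d.-1)
  else ths (inord i.+1).

(* Main.v *)
Require Import Defs.
From HB Require Import structures.
From mathcomp Require Import all_boot all_order all_algebra.
From mathcomp Require Import zify ring.
Import Order.TTheory GRing.Theory Num.Theory.
Local Open Scope ring_scope.
Set Implicit Arguments. Unset Strict Implicit. Unset Printing Implicit Defensive.

(* Choose an eigenbasis of [A] and a basis adapted to the [Es i], and let [Y] be the
   transition matrix.  Then [M Y = Y T] and [L Y = Y B], where [T = diag ths] and the
   irreducible tridiagonal [B] represent [A^*] and [A] in the second basis, while [M]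
   and [L = diag th] represent them in the first one; the support of [M] is [Delta].

   If [Delta] is a path, [M] may be taken irreducible tridiagonal, so that the [ths i]
   are distinct and a matrix commuting with [M] is determined by its first row: if
   this row vanishes beyond column [k], the matrix is a polynomial in [M] of degree at
   most [k].  Choose a diagonal [f] with [f B - B f = T^2 B T - T B T^2].  Transported
   to the first basis, [f] vanishes beyond column 3, hence is a cubic polynomial in
   [T]; read on consecutive indices this is a symmetric biquadratic relation between
   [ths i] and [ths (i+1)], which gives [beta].  The Askey-Wilson expression
   [T^2 B - beta T B T + B T^2 - gs (T B + B T) - rho B] is then diagonal and, by the
   same argument with [k = 2], quadratic in [T]: this is condition (iii).

   Conversely (ii) and (iii) say that the Askey-Wilson expression is quadratic in [T].
   Its entry [(r, s)] in the first basis, for [r, s] not adjacent and with a single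
   common neighbour [c], yields [th s = gamma + beta * th c - th r].  Starting at a
   leaf, the path thus has at most one way to continue, and it reaches every vertex
   because (iv) makes [Delta] connected. *)

(** * Diagonal and irreducible tridiagonal matrices, and their intertwiners *)

Definition irred_tridiag (F : fieldType) (d : nat) (B : 'M[F]_d.+1) : Prop :=
  (forall i j : 'I_d.+1, ((i.+1 < j)%N || (j.+1 < i)%N) -> B i j = 0) /\
  (forall i j : 'I_d.+1, ((i.+1 == j)%N || (j.+1 == i)%N) -> B i j != 0).

Definition dmx (F : fieldType) (n : nat) (f : 'I_n -> F) : 'M[F]_n :=
  diag_mx (\row_i f i).

Lemma dmxE (F : fieldType) (n : nat) (f : 'I_n -> F) i j :
  dmx f i j = f j *+ (i == j).
Proof. by rewrite !mxE; case: eqP => [->|]. Qed.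

Lemma mul_dmx (F : fieldType) (m n : nat) (f : 'I_m -> F) (C : 'M[F]_(m, n)) i j :
  (dmx f *m C) i j = f i * C i j.
Proof. by rewrite mul_diag_mx !mxE. Qed.

Lemma mul_mx_dmx (F : fieldType) (m n : nat) (C : 'M[F]_(m, n)) (f : 'I_n -> F) i j :
  (C *m dmx f) i j = C i j * f j.
Proof. by rewrite mul_mx_diag !mxE. Qed.

Lemma dmx_mulC (F : fieldType) (n : nat) (f g : 'I_n -> F) :
  dmx f *m dmx g = dmx g *m dmx f.
Proof. by rewrite /dmx !mulmx_diag; congr diag_mx; apply/rowP=> i; rewrite !mxE mulrC. Qed.

(** Column k of [C *m B] contains column k+1 of [C] with the nonzero coefficient at (k+1, k) of [B],
    and otherwise only columns up to k; so the columns vanish one after another. [C] is rectangular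
    so that a single row vector, with [G] a scalar, is covered. *)
Lemma tridiag_intertwine0 (F : fieldType) (d m : nat) (B : 'M[F]_d.+1)
    (G : 'M[F]_m) (C : 'M[F]_(m, d.+1)) :
  irred_tridiag B -> C *m B = G *m C -> (forall i, C i ord0 = 0) -> C = 0.
Proof.
move=> [B0 Bn] CB C0.
suff H k (j : 'I_d.+1) : (j <= k)%N -> forall i, C i j = 0.
  by apply/matrixP=> i j; rewrite mxE (H j).
elim: k j => [|k IHk] j.
  by rewrite leqn0 => /eqP j0 i; rewrite -(C0 i); congr (C i _); apply: val_inj.
rewrite leq_eqVlt => /orP[/eqP jk i|/IHk//].
have kd : (k < d.+1)%N by have := ltn_ord j; lia.
pose k' := Ordinal kd.
have := congr1 (fun Z : 'M_(m, d.+1) => Z i k') CB; rewrite !mxE.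
rewrite [RHS]big1 => [|t _]; last by rewrite IHk ?mulr0.
rewrite (bigD1 j) //= big1 ?addr0 => [/eqP|t tj].
  by rewrite mulf_eq0 (negbTE (Bn _ _ _)) ?orbF => [/eqP//|] /=; lia.
case: (leqP t k) => [/IHk->|kt]; first by rewrite mul0r.
rewrite B0 ?mulr0 //=; apply/orP; right.
by move: tj; rewrite -val_eqE /=; lia.
Qed.

Lemma irred_tridiag_tr (F : fieldType) (d : nat) (B : 'M[F]_d.+1) :
  irred_tridiag B -> irred_tridiag B^T.
Proof. by case=> B0 Bn; split=> i j; rewrite orbC mxE => ij; [exact: B0 | exact: Bn]. Qed.

Lemma tridiag_comm0 (F : fieldType) (d : nat) (M N : 'M[F]_d.+1) :
  irred_tridiag M -> N *m M = M *m N -> (forall j, N ord0 j = 0) -> N = 0.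
Proof.
move=> Mt NM N0; apply: trmx_inj; rewrite trmx0.
apply: (@tridiag_intertwine0 _ _ _ M^T M^T); first exact: irred_tridiag_tr.
  by rewrite -!trmx_mul NM.
by move=> i; rewrite mxE.
Qed.

(** * Upper bands and the commutant of an irreducible tridiagonal matrix *)

(** Nothing is asked below the diagonal, since in the end only the first row is read. *)
Definition upper_band (F : fieldType) (n k : nat) (C : 'M[F]_n) : Prop :=
  forall i j : 'I_n, (i + k < j)%N -> C i j = 0.

Lemma upper_band_dmx (F : fieldType) (n : nat) (f : 'I_n -> F) :
  upper_band 0 (dmx f).
Proof.
by move=> i j ij; rewrite dmxE -val_eqE /= (_ : (i == j :> nat) = false) //; lia.
Qed.

Lemma upper_band_mul (F : fieldType) (n k l : nat) (C D : 'M[F]_n) :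
  upper_band k C -> upper_band l D -> upper_band (k + l) (C *m D).
Proof.
move=> Ck Dl i j ij; rewrite mxE big1 // => t _.
case: (ltnP (i + k) t) => it; first by rewrite Ck ?mul0r.
by rewrite Dl ?mulr0 //; lia.
Qed.

(** On the outermost diagonal of the product a single intermediate index survives. *)
Lemma upper_band_mul_edge (F : fieldType) (n k l : nat) (C D : 'M[F]_n)
    (i t j : 'I_n) :
  upper_band k C -> upper_band l D ->
  (t = i + k :> nat)%N -> (j = t + l :> nat)%N -> (C *m D) i j = C i t * D t j.
Proof.
move=> Ck Dl ti jt; rewrite mxE (bigD1 t) //= big1 ?addr0 // => s.
rewrite -val_eqE /= => st; case: (ltnP (i + k) s) => is_.
  by rewrite Ck ?mul0r.
by rewrite Dl ?mulr0 //; lia.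
Qed.

(** The nonzero entry is the product of the first [k] superdiagonal entries of [M]. Thus the first
    rows of the powers of [M] form a triangular system. *)
Lemma irred_tridiag_exp_edge (F : fieldType) (d k : nat) (M : 'M[F]_d.+1) :
  irred_tridiag M -> upper_band k (M ^+ k) /\
  (forall j : 'I_d.+1, j = k :> nat -> (M ^+ k) ord0 j != 0).
Proof.
move=> Mt; have M1 : upper_band 1 M.
  by move=> i j ij; apply: (proj1 Mt); rewrite addn1 in ij; rewrite ij.
elim: k => [|k [IH1 IH2]].
  split=> [i j ij|j j0].
    by rewrite expr0 mxE -val_eqE /= (_ : (i == j :> nat) = false) //; lia.
  by rewrite expr0 mxE (_ : ord0 == j) ?oner_neq0 // -val_eqE /= j0.
rewrite exprSr; split; first by have := upper_band_mul IH1 M1; rewrite addn1.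
move=> j jk; have kd : (k < d.+1)%N by have := ltn_ord j; lia.
have -> : (M ^+ k * M) ord0 j = (M ^+ k) ord0 (Ordinal kd) * M (Ordinal kd) j.
  by apply: (upper_band_mul_edge (k := k) (l := 1)) => //=; lia.
by rewrite mulf_neq0 ?IH2 // (proj2 Mt) //= jk eqxx.
Qed.

(** A multiple of [M ^+ k] clears column [k] of the first row and creates no entry further right. *)
Lemma tridiag_comm_peel (F : fieldType) (d k : nat) (M N : 'M[F]_d.+1) :
  irred_tridiag M -> N *m M = M *m N ->
  (forall j : 'I_d.+1, (k < j)%N -> N ord0 j = 0) ->
  exists c : F, let N' := N - c *: M ^+ k in
    N' *m M = M *m N' /\ (forall j : 'I_d.+1, (k <= j)%N -> N' ord0 j = 0).
Proof.
move=> Mt NM N0; have [band edge] := irred_tridiag_exp_edge k Mt.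
have comm c : (N - c *: M ^+ k) *m M = M *m (N - c *: M ^+ k).
  rewrite mulmxBl mulmxBr NM -scalemxAl -scalemxAr; congr (_ - _ *: _).
  by rewrite -[LHS]exprSr -[RHS]exprS.
(* Beyond the last index there is no column to clear, and the coefficient 0 serves. *)
case: (ltnP k d.+1) => kd; last first.
  by exists 0; split=> // j jk; have := ltn_ord j; lia.
exists (N ord0 (Ordinal kd) / (M ^+ k) ord0 (Ordinal kd)); split=> // j.
rewrite leq_eqVlt => /orP[/eqP kj|kj].
  have -> : j = Ordinal kd by apply: val_inj.
  by rewrite !mxE divfK ?subrr // edge.
by rewrite !mxE (N0 _ kj) (band ord0 j kj) mulr0 subrr.
Qed.

(** Clearing columns 2, 1 and 0 leaves a matrix that commutes with [M] and has zero first row, hence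
    is 0. *)
Lemma tridiag_comm_quadratic (F : fieldType) (d : nat) (M N : 'M[F]_d.+1) :
  irred_tridiag M -> N *m M = M *m N ->
  (forall j : 'I_d.+1, (2 < j)%N -> N ord0 j = 0) ->
  exists c2 c1 c0 : F, N = c2 *: (M *m M) + c1 *: M + c0%:M.
Proof.
move=> Mt NM N0.
have [c2 [NM2 N2]] := tridiag_comm_peel Mt NM N0.
have [c1 [NM1 N1]] := tridiag_comm_peel Mt NM2 N2.
have [c0 [NM0 N00]] := tridiag_comm_peel Mt NM1 N1.
exists c2, c1, c0.
have /eqP := tridiag_comm0 Mt NM0 (fun j => N00 j isT).
rewrite !subr_eq add0r expr0 expr1 expr2 => /eqP->.
by rewrite -scalemx1 addrC [X in _ + X]addrC addrA.
Qed.

(** * Simple spectrum, and diagonal matrices as polynomials in [dmx ths] *)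

(** An eigenvector of [M] whose first coordinate is 0 vanishes, so two independent eigenvectors
    cannot share an eigenvalue. *)
Lemma tridiag_spectrum_inj (F : fieldType) (d : nat) (M Y : 'M[F]_d.+1)
    (ths : 'I_d.+1 -> F) :
  irred_tridiag M -> Y \in unitmx -> M *m Y = Y *m dmx ths -> injective ths.
Proof.
move=> Mt Yu MY.
have eig0 t (w : 'cV_d.+1) :
    dmx ths *m w = t *: w -> (Y *m w) ord0 ord0 = 0 -> w = 0.
  move=> Tw w0; rewrite -(mulKmx Yu w) [Y *m w](_ : _ = 0) ?mulmx0 //.
  apply: trmx_inj; rewrite trmx0.
  apply: (@tridiag_intertwine0 _ _ _ M^T t%:M); first exact: irred_tridiag_tr.
    by rewrite -trmx_mul mulmxA MY -mulmxA Tw -scalemxAr linearZ mul_scalar_mx.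
  by move=> i; rewrite mxE ord1.
have Tdelta i : dmx ths *m delta_mx i ord0 = ths i *: (delta_mx i ord0 : 'cV_d.+1).
  apply/matrixP=> r s; rewrite mul_dmx !mxE.
  by case: eqP => [->//|_]; rewrite /= !mulr0.
have delta_neq0 i : (delta_mx i ord0 : 'cV[F]_d.+1) != 0.
  by apply/eqP => /matrixP/(_ i ord0)/eqP; rewrite !mxE !eqxx oner_eq0.
have Y0 i : Y ord0 i != 0.
  apply: contra (delta_neq0 i) => /eqP Yi; apply/eqP; apply: eig0 (Tdelta i) _.
  by rewrite -colE mxE.
move=> i j ij; apply/eqP; apply: contraT => nij.
(* The combination of columns [i] and [j] of [Y] whose first coordinate cancels. *)
pose w : 'cV[F]_d.+1 := Y ord0 j *: delta_mx i ord0 - Y ord0 i *: delta_mx j ord0.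
have /matrixP/(_ i ord0)/eqP: w = 0.
  apply: (eig0 (ths i)).
    by rewrite mulmxBr -!scalemxAr !Tdelta scalerBr !scalerA -ij !(mulrC (ths i)).
  by rewrite mulmxBr -!scalemxAr -!colE !mxE mulrC subrr.
by rewrite !mxE !eqxx (negbTE nij) mulr1 mulr0 subr0 (negbTE (Y0 j)).
Qed.

Lemma conj_diag_comm (F : fieldType) (n : nat) (M N Y : 'M[F]_n)
    (f g : 'I_n -> F) : Y \in unitmx ->
  M *m Y = Y *m dmx f -> N *m Y = Y *m dmx g -> N *m M = M *m N.
Proof.
move=> Yu MY NY; apply: (can_inj (mulmxK Yu)).
by rewrite -!mulmxA MY NY !mulmxA MY NY -!mulmxA dmx_mulC.
Qed.

(** [M] and [N] are diagonal in the same basis, so they commute and [N] is quadratic in [M];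
    conjugating by [Y] turns this into a relation between eigenvalues. *)
Lemma diag_quadratic (F : fieldType) (d : nat) (M N Y : 'M[F]_d.+1)
    (ths g : 'I_d.+1 -> F) :
  irred_tridiag M -> Y \in unitmx -> M *m Y = Y *m dmx ths -> N *m Y = Y *m dmx g ->
  (forall j : 'I_d.+1, (2 < j)%N -> N ord0 j = 0) ->
  exists c2 c1 c0 : F, forall i, g i = c2 * ths i ^+ 2 + c1 * ths i + c0.
Proof.
move=> Mt Yu MY NY N0.
have [c2 [c1 [c0 E]]] := tridiag_comm_quadratic Mt (conj_diag_comm Yu MY NY) N0.
exists c2, c1, c0 => i.
have : Y *m dmx g = Y *m (c2 *: (dmx ths *m dmx ths) + c1 *: dmx ths + c0%:M).
  rewrite -NY E !mulmxDl !mulmxDr -!scalemxAl -!scalemxAr -mulmxA MY !mulmxA MY.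
  by rewrite scalar_mxC.
move/(can_inj (mulKmx Yu))/matrixP/(_ i i).
have E2 : (dmx ths *m dmx ths) i i = ths i ^+ 2 by rewrite mul_dmx dmxE eqxx expr2.
have addE (C D : 'M[F]_d.+1) : (C + D) i i = C i i + D i i by rewrite mxE.
have scaleE c (C : 'M[F]_d.+1) : (c *: C) i i = c * C i i by rewrite mxE.
by rewrite !addE !scaleE E2 !dmxE !mxE eqxx.
Qed.

(** * The extended sequence [ths] and the Askey-Wilson expression *)

Lemma ths_prev_next (F : fieldType) (d : nat) (ths : 'I_d.+1 -> F) (beta gs : F)
    (i : 'I_d.+1) : (0 < d)%N ->
  (forall i : nat, (1 <= i)%N -> (i <= d.-1)%N ->
     gs = ths (inord i.-1) - beta * ths (inord i) + ths (inord i.+1)) ->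
  ths_prev ths beta gs i + ths_next ths beta gs i = gs + beta * ths i.
Proof.
move=> d0 rec; rewrite /ths_prev /ths_next; case: eqP => i0.
  have -> : i = inord 0 by apply: val_inj; rewrite /= inordK.
  rewrite inordK // ifF ?subrK //; lia.
case: eqP => [id_|ind].
  have -> : i = inord d by apply: val_inj; rewrite /= inordK.
  by rewrite inordK // addrC subrK.
have id_ : (i <= d)%N by rewrite -ltnS.
rewrite (rec i); [|lia|lia]; rewrite inord_val; ring.
Qed.

(** With t = [ths i], the previous and next values are the two roots of x^2 - (beta t + gs) x + t^2
    - gs t - rho: their sum is right, and one of them is a root by the edge relation. The claim is
    the value of this polynomial at x = t. *)
Lemma ths_prev_next_prod (F : fieldType) (d : nat) (ths : 'I_d.+1 -> F)
    (beta gs rho : F) (i : 'I_d.+1) : (0 < d)%N ->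
  (forall i : nat, (1 <= i)%N -> (i <= d.-1)%N ->
     gs = ths (inord i.-1) - beta * ths (inord i) + ths (inord i.+1)) ->
  (forall i : nat, (i < d)%N -> ths (inord i) ^+ 2
      - beta * ths (inord i) * ths (inord i.+1) + ths (inord i.+1) ^+ 2
      - gs * (ths (inord i) + ths (inord i.+1)) = rho) ->
  (ths i - ths_prev ths beta gs i) * (ths i - ths_next ths beta gs i)
    = ths i ^+ 2 - beta * ths i * ths i + ths i ^+ 2 - gs * (ths i + ths i) - rho.
Proof.
move=> d0 rec edge; have pn := ths_prev_next i d0 rec.
have id_ : (i <= d)%N by rewrite -ltnS.
case: (ltnP i d) => ltid.
  have nx : ths_next ths beta gs i = ths (inord i.+1) by rewrite /ths_next ifF //; lia.
  have /eqP := pn; rewrite -(edge i ltid) nx inord_val eq_sym -subr_eq => /eqP<-; ring.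
(* At the last index [ths_next] is the extrapolated value, so the known root is the previous one, by
   symmetry of the edge relation. *)
have [id' i0] : i = d :> nat /\ (i == 0 :> nat)%N = false by lia.
have pv : ths_prev ths beta gs i = ths (inord d.-1) by rewrite /ths_prev i0 id'.
have ei : ths (inord d) = ths i by congr ths; apply: val_inj; rewrite /= inordK.
have := edge d.-1; rewrite prednK // leqnn => /(_ isT)<-; rewrite ei.
move/eqP: pn; rewrite pv addrC eq_sym -subr_eq => /eqP<-; ring.
Qed.

(** The cubic side of the Askey-Wilson relation. For diagonal [T] it multiplies each entry of [B] by
    a symmetric biquadratic in the two eigenvalues. *)
Definition aw_poly (F : fieldType) (n : nat) (T B : 'M[F]_n) (beta gs rho : F) :=
  T *m T *m B - beta *: (T *m B *m T) + B *m (T *m T)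
  - gs *: (T *m B + B *m T) - rho *: B.

Lemma aw_poly_conj (F : fieldType) (n : nat) (M L Y T B : 'M[F]_n) (beta gs rho : F) :
  M *m Y = Y *m T -> L *m Y = Y *m B ->
  aw_poly M L beta gs rho *m Y = Y *m aw_poly T B beta gs rho.
Proof.
move=> MY LY; rewrite /aw_poly.
rewrite !(mulmxDl, mulmxDr, mulNmx, mulmxN) -!scalemxAl -!scalemxAr.
have MY' C : M *m (Y *m C) = Y *m (T *m C) by rewrite !mulmxA MY.
have LY' C : L *m (Y *m C) = Y *m (B *m C) by rewrite !mulmxA LY.
by rewrite !(mulmxDl, mulmxDr) -!mulmxA !(MY, LY, MY', LY').
Qed.

Lemma aw_poly_dmxE (F : fieldType) (n : nat) (ths : 'I_n -> F) (B : 'M[F]_n)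
    (beta gs rho : F) i j :
  aw_poly (dmx ths) B beta gs rho i j =
  B i j * (ths i ^+ 2 - beta * ths i * ths j + ths j ^+ 2 - gs * (ths i + ths j) - rho).
Proof.
rewrite /aw_poly.
have E (C D : 'M[F]_n) : (C + D) i j = C i j + D i j by rewrite mxE.
have O (C : 'M[F]_n) : (- C) i j = - C i j by rewrite mxE.
have Z c (C : 'M[F]_n) : (c *: C) i j = c * C i j by rewrite mxE.
rewrite !(E, O, Z) mulmxA -[dmx ths *m dmx ths *m B]mulmxA.
rewrite !(mul_mx_dmx, mul_dmx); ring.
Qed.

(** Off the diagonal either the entry of [B] or, for neighbouring indices, the biquadratic factor
    vanishes. *)
Lemma aw_poly_tridiag (F : fieldType) (d : nat) (ths : 'I_d.+1 -> F) (B : 'M[F]_d.+1)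
    (beta gs rho : F) : (0 < d)%N -> irred_tridiag B ->
  (forall i : nat, (1 <= i)%N -> (i <= d.-1)%N ->
     gs = ths (inord i.-1) - beta * ths (inord i) + ths (inord i.+1)) ->
  (forall i : nat, (i < d)%N -> ths (inord i) ^+ 2
      - beta * ths (inord i) * ths (inord i.+1) + ths (inord i.+1) ^+ 2
      - gs * (ths (inord i) + ths (inord i.+1)) = rho) ->
  aw_poly (dmx ths) B beta gs rho =
  dmx (fun i => B i i * (ths i - ths_prev ths beta gs i)
                      * (ths i - ths_next ths beta gs i)).
Proof.
move=> d0 [B0 _] rec edge; apply/matrixP=> i j; rewrite aw_poly_dmxE dmxE.
case: eqVneq => [<-|]; first by rewrite mulr1n -[RHS]mulrA (ths_prev_next_prod _ d0 rec edge).
rewrite -val_eqE /= mulr0n => nij.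
have [iLd jLd] : (i <= d /\ j <= d)%N by split; rewrite -ltnS.
case: (boolP ((i.+1 < j)%N || (j.+1 < i)%N)) => [/B0->|far]; first by rewrite mul0r.
case: (ltngtP i j) nij => // lij _.
  have := edge i; rewrite (_ : i.+1 = j :> nat) ?inord_val; last lia.
  by move=> /(_ _)<-; [ring|lia].
have := edge j; rewrite (_ : j.+1 = i :> nat) ?inord_val; last lia.
by move=> /(_ _)<-; [ring|lia].
Qed.

Lemma upper_band_tridiag (F : fieldType) (d : nat) (M : 'M[F]_d.+1) :
  irred_tridiag M -> upper_band 1 M.
Proof. by case=> M0 _ i j ij; apply: M0; rewrite addn1 in ij; rewrite ij. Qed.

(** * From a path to the recurrence and the quadratic for [B i i] *)

Lemma diag_cubic (F : fieldType) (d : nat) (M N Y : 'M[F]_d.+1)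
    (ths g : 'I_d.+1 -> F) :
  irred_tridiag M -> Y \in unitmx -> M *m Y = Y *m dmx ths -> N *m Y = Y *m dmx g ->
  (forall j : 'I_d.+1, (3 < j)%N -> N ord0 j = 0) ->
  (exists2 j : 'I_d.+1, j = 3 :> nat & N ord0 j != 0) ->
  exists c3 c2 c1 c0 : F, c3 != 0 /\
    forall i, g i = c3 * ths i ^+ 3 + c2 * ths i ^+ 2 + c1 * ths i + c0.
Proof.
move=> Mt Yu MY NY N0 [j3 j3E Nj3].
have [c3 [NM3 N3]] := tridiag_comm_peel Mt (conj_diag_comm Yu MY NY) N0.
pose g' i := g i - c3 * ths i ^+ 3.
have N'Y : (N - c3 *: M ^+ 3) *m Y = Y *m dmx g'.
  have M3Y : M ^+ 3 *m Y = Y *m (dmx ths *m (dmx ths *m dmx ths)).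
    have -> : M ^+ 3 = M *m (M *m M) by rewrite exprS expr2.
    by rewrite -!mulmxA MY !(mulmxA M Y) MY -!mulmxA (mulmxA M Y) MY -!mulmxA.
  rewrite mulmxBl NY -scalemxAl M3Y scalemxAr -mulmxBr; congr (_ *m _).
  have subE (C D : 'M[F]_d.+1) i j : (C - D) i j = C i j - D i j by rewrite !mxE.
  have scaleE c (C : 'M[F]_d.+1) i j : (c *: C) i j = c * C i j by rewrite mxE.
  apply/matrixP=> i j; rewrite subE scaleE !mul_dmx !dmxE /g'.
  by case: eqP => [->|_]; rewrite ?mulr1n ?mulr0n; ring.
have [c2 [c1 [c0 E]]] := diag_quadratic Mt Yu MY N'Y N3.
exists c3, c2, c1, c0; split; last first.
  by move=> i; have /eqP := E i; rewrite subr_eq => /eqP->; ring.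
(* With leading coefficient 0 nothing was subtracted, so the entry in column 3 would already be
   0. *)
apply: contraNneq Nj3 => c30; apply/eqP.
have := N3 j3; rewrite j3E => /(_ isT).
by rewrite c30 scale0r subr0.
Qed.

Lemma qpoly_recurrence_poly (F : fieldType) (d : nat) (M B Y : 'M[F]_d.+1)
    (th ths : 'I_d.+1 -> F) :
  (3 <= d)%N -> injective th -> irred_tridiag M -> irred_tridiag B -> Y \in unitmx ->
  M *m Y = Y *m dmx ths -> dmx th *m Y = Y *m B ->
  exists beta gs rho : F, forall i : nat, (i < d)%N -> ths (inord i) ^+ 2
      - beta * ths (inord i) * ths (inord i.+1) + ths (inord i.+1) ^+ 2
      - gs * (ths (inord i) + ths (inord i.+1)) = rho.
Proof.
move=> d3 th_inj Mt Bt Yu MY LY.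
have ths_inj := tridiag_spectrum_inj Mt Yu MY.
pose t k := ths (inord k); set L := dmx th in LY.
(* A telescoping sum, so that f_i - f_j = t_i t_j (t_i - t_j) for neighbouring indices; this is all
   that the commutator with the tridiagonal [B] sees. *)
pose f (i : 'I_d.+1) := \sum_(k < i) (t k * t k.+1 * (t k.+1 - t k)).
have fS k : (k < d)%N -> f (inord k.+1) - f (inord k) = t k * t k.+1 * (t k.+1 - t k).
  move=> kd; have kE : (inord k.+1 : 'I_d.+1) = (inord k : 'I_d.+1).+1 :> nat.
    by rewrite !inordK // ltnW.
  by rewrite /f kE big_ord_recr /= addrAC subrr add0r inordK // ltnW.
have [N NY] : exists N : 'M_d.+1, N *m Y = Y *m dmx f.
  by exists (Y *m dmx f *m invmx Y); rewrite mulmxKV.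
have fB : dmx f *m B - B *m dmx f =
    dmx ths *m (dmx ths *m (B *m dmx ths)) - dmx ths *m (B *m (dmx ths *m dmx ths)).
  have subE (C D : 'M[F]_d.+1) i j : (C - D) i j = C i j - D i j by rewrite !mxE.
  apply/matrixP=> i j; rewrite !mulmxA -[_ *m B *m dmx ths]mulmxA -![dmx ths *m dmx ths *m _]mulmxA.
  rewrite !subE !(mul_mx_dmx, mul_dmx).
  have [iLd jLd] : (i <= d /\ j <= d)%N by split; rewrite -ltnS.
  case: (boolP ((i.+1 < j)%N || (j.+1 < i)%N)) => [/(proj1 Bt)->|far].
    by rewrite !(mulr0, mul0r).
  case: (ltngtP i j) => lij.
  - have := fS i; rewrite /t (_ : i.+1 = j :> nat) ?inord_val; last lia.
    move=> /(_ _)/(canRL (subrK _))->; [ring|lia].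
  - have := fS j; rewrite /t (_ : j.+1 = i :> nat) ?inord_val; last lia.
    move=> /(_ _)/(canRL (subrK _))->; [ring|lia].
  - rewrite (val_inj lij); ring.
have NL : N *m L - L *m N = M *m (M *m (L *m M)) - M *m (L *m (M *m M)).
  have MY' C : M *m (Y *m C) = Y *m (dmx ths *m C) by rewrite !mulmxA MY.
  have LY' C : L *m (Y *m C) = Y *m (B *m C) by rewrite !mulmxA LY.
  have NY' C : N *m (Y *m C) = Y *m (dmx f *m C) by rewrite !mulmxA NY.
  apply: (can_inj (mulmxK Yu)); rewrite !mulmxBl -!mulmxA.
  by rewrite !(MY, LY, NY, MY', LY', NY') -mulmxBr fB mulmxBr.
(* As [L] is diagonal with distinct entries, the commutator determines the first row of [N] off the
   diagonal. The right side has band 3. *)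
have NLE j : N ord0 j * (th j - th ord0) =
    (M *m (M *m (L *m M))) ord0 j - (M *m (L *m (M *m M))) ord0 j.
  have := congr1 (fun Z : 'M_d.+1 => Z ord0 j) NL; rewrite mxE [X in X + _]mul_mx_dmx.
  rewrite [X in _ + X]mxE mul_dmx [X in _ = X -> _]mxE [X in _ = _ + X -> _]mxE => <-; ring.
have bM := upper_band_tridiag Mt; have bL := upper_band_dmx th.
have bMM := upper_band_mul bM bM; have bLM := upper_band_mul bL bM.
have bMLM := upper_band_mul bM bLM; have bLMM := upper_band_mul bL bMM.
pose o k : 'I_d.+1 := inord k.
have oE k : (k <= 3)%N -> o k = k :> nat by move=> k3; rewrite inordK //; lia.
have thN (i j : 'I_d.+1) : i != j :> nat -> th j - th i != 0.
  by rewrite subr_eq0 => ij; apply: contra ij => /eqP/th_inj->.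
have [] := @diag_cubic _ _ M N Y ths f Mt Yu MY NY.
- move=> j j3; have /eqP := NLE j; rewrite (upper_band_mul bM bMLM) //.
  rewrite (upper_band_mul bM bLMM) // subrr mulf_eq0 (negbTE (thN ord0 j _)) ?orbF => [/eqP//|].
  by rewrite /=; lia.
- exists (o 3); first exact: oE.
  have := NLE (o 3).
  rewrite (upper_band_mul_edge (t := o 1) bM bMLM) ?oE //.
  rewrite (upper_band_mul_edge (t := o 2) bM bLM) ?oE //.
  rewrite (upper_band_mul_edge (t := o 1) bM bLMM) ?oE // !mul_dmx.
  rewrite (upper_band_mul_edge (t := o 2) bM bM) ?oE // => E.
  have: N ord0 (o 3) * (th (o 3) - th ord0) != 0.
    (* Both cubic words reach column 3 only along 0, 1, 2, 3; they differ in where [L] is read, at 2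
       or at 1. *)
    rewrite E (_ : _ - _ = M ord0 (o 1) * M (o 1) (o 2) * M (o 2) (o 3)
                           * (th (o 2) - th (o 1))); last by ring.
    by rewrite !mulf_neq0 ?(proj2 Mt) ?thN ?oE.
  by apply: contraNneq => ->; rewrite mul0r.
move=> c3 [c2 [c1 [c0 [c3n fE]]]].
(* The difference of the cubic at consecutive t and t', divided by t' - t, gives c3 (t^2 + t t' +
   t'^2) + c2 (t + t') + c1 = t t'; dividing by c3 yields these values. *)
exists (c3^-1 - 1), (- c2 / c3), (- c1 / c3) => i lid.
have tn : t i.+1 - t i != 0.
  rewrite subr_eq0; apply/eqP => /ths_inj/(congr1 val); rewrite /= !inordK; lia.
have := fS i lid; rewrite !fE -/(t i) -/(t i.+1) => E.
apply: (mulIf tn); apply: (mulfI c3n).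
have -> : c3 * ((t i ^+ 2 - (c3^-1 - 1) * t i * t i.+1 + t i.+1 ^+ 2
    - - c2 / c3 * (t i + t i.+1)) * (t i.+1 - t i)) =
   (c3 * t i.+1 ^+ 3 + c2 * t i.+1 ^+ 2 + c1 * t i.+1 + c0 -
    (c3 * t i ^+ 3 + c2 * t i ^+ 2 + c1 * t i + c0)) - t i * t i.+1 * (t i.+1 - t i)
   - c1 * (t i.+1 - t i).
  by field.
by rewrite E; field.
Qed.

Lemma qpoly_parameters (F : fieldType) (d : nat) (M B Y : 'M[F]_d.+1)
    (th ths : 'I_d.+1 -> F) :
  (0 < d)%N -> injective th -> irred_tridiag M -> irred_tridiag B -> Y \in unitmx ->
  M *m Y = Y *m dmx ths -> dmx th *m Y = Y *m B ->
  exists beta gs : F,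
    (forall i : nat, (1 <= i)%N -> (i <= d.-1)%N ->
       gs = ths (inord i.-1) - beta * ths (inord i) + ths (inord i.+1)) /\
    exists gamma omega etas : F, forall i : 'I_d.+1,
      B i i * (ths i - ths_prev ths beta gs i) * (ths i - ths_next ths beta gs i)
      = gamma * ths i ^+ 2 + omega * ths i + etas.
Proof.
move=> d0 th_inj Mt Bt Yu MY LY.
have ths_inj := tridiag_spectrum_inj Mt Yu MY.
have NY g : Y *m dmx g *m invmx Y *m Y = Y *m dmx g by rewrite mulmxKV.
case: (ltnP 2 d) => d3; last first.
  (* For [d] at most 2 the recurrence has at most the instance i = 1, met by this choice, and no
     column lies beyond 2. *)
  exists 0, (ths (inord 0) + ths (inord 2)); split.
    by move=> i i1 id_; have -> : i = 1%N by [lia]; rewrite mul0r subr0.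
  apply: (diag_quadratic Mt Yu MY (NY _)) => j j2; have := ltn_ord j; lia.
have [beta [gs [rho edge]]] := qpoly_recurrence_poly d3 th_inj Mt Bt Yu MY LY.
(* The difference of two consecutive edge relations is divisible by ths_{i+1} - ths_{i-1}, which is
   nonzero. *)
have rec i : (1 <= i)%N -> (i <= d.-1)%N ->
    gs = ths (inord i.-1) - beta * ths (inord i) + ths (inord i.+1).
  case: i => // i _ id_ /=.
  have tn : ths (inord i.+2) - ths (inord i) != 0.
    rewrite subr_eq0; apply/eqP => /ths_inj/(congr1 val); rewrite /= !inordK; lia.
  have E1 : (i < d)%N by lia.
  have E2 : (i.+1 < d)%N by lia.
  apply: (mulIf tn); have := edge _ E2; rewrite -(edge _ E1) => /eqP.
  rewrite -subr_eq0 => /eqP E; apply/eqP; rewrite eq_sym -subr_eq0 -E; apply/eqP; ring.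
exists beta, gs; split=> //.
have G := aw_poly_tridiag d0 Bt rec edge.
apply: (diag_quadratic Mt Yu MY (N := aw_poly M (dmx th) beta gs rho)).
  by rewrite (aw_poly_conj _ _ _ MY LY) G.
move=> j j2; rewrite /aw_poly.
have bM := upper_band_tridiag Mt; have bL := upper_band_dmx th.
have bMM := upper_band_mul bM bM; have bLM := upper_band_mul bL bM.
have bML := upper_band_mul bM bL.
have addE (C D : 'M[F]_d.+1) i k : (C + D) i k = C i k + D i k by rewrite mxE.
have oppE (C : 'M[F]_d.+1) i k : (- C) i k = - C i k by rewrite mxE.
have scaleE c (C : 'M[F]_d.+1) i k : (c *: C) i k = c * C i k by rewrite mxE.
rewrite !(addE, oppE, scaleE) (upper_band_mul bMM bL) // (upper_band_mul bML bM) //.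
rewrite (upper_band_mul bL bMM) // (bML ord0 j) ?(bLM ord0 j) ?(bL ord0 j) //=; try lia.
by rewrite !(addr0, mulr0, oppr0).
Qed.

(** * Symmetry and connectedness of the support of [M] *)

(** Successive ratios of [h] are forced to be the subdiagonal entry over the superdiagonal one. *)
Lemma tridiag_symmetrizable (F : fieldType) (d : nat) (B : 'M[F]_d.+1) :
  irred_tridiag B ->
  exists2 h : 'I_d.+1 -> F, forall i, h i != 0 & B *m dmx h = dmx h *m B^T.
Proof.
move=> [B0 Bn].
pose q k := B (inord k.+1) (inord k) / B (inord k) (inord k.+1).
pose h (i : 'I_d.+1) := \prod_(k < i) q k.
have hS (i j : 'I_d.+1) : i.+1 = j -> B i j * h j = h i * B j i.
  move=> ij; have := Bn i j; rewrite ij eqxx => /(_ isT) Bij.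
  rewrite /h -ij big_ord_recr /= /q ij !inord_val; field; exact: Bij.
exists h => [i|].
  apply/prodf_neq0 => k _; have kd : (k.+1 < d.+1)%N.
    by have := ltn_ord i; have := ltn_ord k; lia.
  by rewrite mulf_neq0 ?invr_eq0 // Bn // !inordK ?eqxx ?orbT //; lia.
apply/matrixP=> i j; rewrite mul_mx_dmx mul_dmx mxE.
case: (boolP ((i.+1 < j)%N || (j.+1 < i)%N)) => [far|far].
  by rewrite !B0 ?mul0r ?mulr0 // orbC.
case: (ltngtP i j) => lij.
- by apply: hS; lia.
- have ji : j.+1 = i by lia.
  by rewrite mulrC -(hS j i ji) mulrC.
- by rewrite (val_inj lij) mulrC.
Qed.

(* With [h] symmetrizing [B], the matrix [Y h Y^T] commutes with [dmx th], hence is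
   diagonal, and it symmetrizes [M]. *)
Lemma dual_support_sym (F : fieldType) (d : nat) (M B Y : 'M[F]_d.+1)
    (th ths : 'I_d.+1 -> F) i j :
  injective th -> irred_tridiag B -> Y \in unitmx ->
  M *m Y = Y *m dmx ths -> dmx th *m Y = Y *m B -> (M i j == 0) = (M j i == 0).
Proof.
move=> th_inj Bt Yu MY LY; have [h hn Bh] := tridiag_symmetrizable Bt.
pose Z := Y *m dmx h *m Y^T.
have LZ : dmx th *m Z = Z *m dmx th.
  have YtL : Y^T *m dmx th = B^T *m Y^T.
    by rewrite -trmx_mul -LY trmx_mul [(dmx th)^T]tr_diag_mx.
  by rewrite /Z -(mulmxA _ Y^T) YtL !mulmxA LY -(mulmxA Y B) Bh !mulmxA.
have Zd a b : a != b -> Z a b = 0.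
  move=> ab; have := congr1 (fun C : 'M_d.+1 => C a b) LZ.
  rewrite mul_dmx mul_mx_dmx mulrC => /eqP; rewrite -subr_eq0 -mulrBr mulf_eq0 subr_eq0.
  by case/orP=> [/eqP//|/eqP/th_inj ab']; rewrite ab' eqxx in ab.
have hu : dmx h \in unitmx.
  rewrite unitmxE det_diag unitfE; apply/prodf_neq0 => k _; by rewrite mxE.
have Zu : Z \in unitmx by rewrite !unitmx_mul unitmx_tr Yu hu.
have Zn a : Z a a != 0.
  apply/eqP => Za; have: delta_mx (0 : 'I_1) a *m Z = 0.
    rewrite -rowE; apply/rowP=> b; rewrite mxE [RHS]mxE.
    by case: (eqVneq a b) => [<-//|/Zd].
  move/(canRL (mulmxK Zu)); rewrite mul0mx => /matrixP/(_ 0 a)/eqP.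
  by rewrite !mxE !eqxx oner_eq0.
have MZ a b : (M *m Z) a b = M a b * Z b b.
  rewrite mxE (bigD1 b) //= big1 ?addr0 // => k kb; by rewrite Zd ?mulr0.
have: (M *m Z)^T = M *m Z.
  have dT g : (dmx g)^T = dmx g :> 'M[F]_d.+1 by exact: tr_diag_mx.
  by rewrite /Z !mulmxA MY !trmx_mul trmxK !dT !mulmxA -(mulmxA Y (dmx h)) dmx_mulC !mulmxA.
move/matrixP/(_ i j); rewrite mxE !MZ => E.
have := congr1 (fun x => x == 0) E.
by rewrite /= !mulf_eq0 !(negbTE (Zn _)) !orbF => ->.
Qed.

(** The indicator of a union of components commutes with [M] and [dmx th], so its transport [Q]
    commutes with [dmx ths] and [B]. Since [ths ord0] is not repeated, column 0 of [Q] is supported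
    on the diagonal; subtracting that scalar gives 0, so the indicator is constant. *)
Lemma dual_connected (F : fieldType) (d : nat) (M B Y : 'M[F]_d.+1)
    (th ths : 'I_d.+1 -> F) (S : {set 'I_d.+1}) :
  irred_tridiag B -> Y \in unitmx ->
  M *m Y = Y *m dmx ths -> dmx th *m Y = Y *m B ->
  (forall i, i != ord0 -> ths i != ths ord0) ->
  (forall i j, i \in S -> j \notin S -> M i j = 0 /\ M j i = 0) ->
  S = set0 \/ S = setT.
Proof.
move=> Bt Yu MY LY ths0 SM.
pose p (i : 'I_d.+1) : F := (i \in S)%:R.
have pM : dmx p *m M = M *m dmx p.
  apply/matrixP=> i j; rewrite mul_dmx mul_mx_dmx /p.
  case: (boolP (i \in S)) => iS; case: (boolP (j \in S)) => jS.
  - by rewrite mulrC.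
  - by rewrite (proj1 (SM i j iS jS)) mulr0 mul0r.
  - by rewrite (proj2 (SM j i jS iS)) mulr0 mul0r.
  - by rewrite mulrC.
have [Q YQ] : exists Q : 'M_d.+1, Y *m Q = dmx p *m Y.
  by exists (invmx Y *m (dmx p *m Y)); rewrite mulKVmx.
have QB : Q *m B = B *m Q.
  apply: (can_inj (mulKmx Yu)).
  by rewrite !mulmxA YQ -(mulmxA (dmx p)) -!LY !mulmxA -[RHS]mulmxA YQ mulmxA dmx_mulC.
have QT : Q *m dmx ths = dmx ths *m Q.
  apply: (can_inj (mulKmx Yu)).
  by rewrite !mulmxA YQ -(mulmxA (dmx p)) -!MY !mulmxA -[RHS]mulmxA YQ mulmxA pM.
have Q0 i : i != ord0 -> Q i ord0 = 0.
  move=> i0; have := congr1 (fun C : 'M_d.+1 => C i ord0) QT.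
  rewrite mul_dmx mul_mx_dmx mulrC => /eqP; rewrite -subr_eq0 -mulrBl mulf_eq0.
  by rewrite subr_eq0 eq_sym (negbTE (ths0 i i0)) => /eqP.
have : Q - (Q ord0 ord0)%:M = 0.
  apply: (tridiag_intertwine0 Bt (G := B)).
    by rewrite mulmxBl mulmxBr QB scalar_mxC.
  move=> i; rewrite !mxE; case: (eqVneq i ord0) => [->|i0]; first by rewrite subrr.
  by rewrite (Q0 _ i0) mulr0n subr0.
move/eqP; rewrite subr_eq0 => /eqP Qq.
have: dmx p = (Q ord0 ord0)%:M.
  by apply: (can_inj (mulmxK Yu)); rewrite -YQ {1}Qq scalar_mxC.
move=> /matrixP pq.
have pc i : p i = Q ord0 ord0 by have := pq i i; rewrite dmxE mxE eqxx !mulr1n.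
case: (boolP (ord0 \in S)) => S0; [right|left]; apply/setP=> i; rewrite !inE;
  have := pc i; rewrite -(pc ord0) /p; move: S0; case: (ord0 \in S) => // _;
  case: (i \in S) => //= /eqP; by rewrite ?oner_eq0 // eq_sym oner_eq0.
Qed.

(** * Growing a path from a leaf *)

(* [path_prefix k x]: [x 0, .., x k] starts a path that only [x k] can leave. *)
Definition path_prefix (T : eqType) (adj : rel T) (k : nat) (x : nat -> T) : Prop :=
  [/\ {in [pred a | (a <= k)%N] &, injective x},
      forall a, (a < k)%N -> adj (x a) (x a.+1)
    & forall a w, (a < k)%N -> adj (x a) w -> w = x a.+1 \/ (0 < a)%N /\ w = x a.-1].

(** Connectedness supplies an edge leaving the prefix, necessarily from its last vertex. The new
    vertex is unique: at the start because it is a leaf, later because [nxt] fixes its label and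
    labels are distinct. *)
Lemma path_graph_of_leaf (d : nat) (adj : rel 'I_d.+1) (K : eqType)
    (th : 'I_d.+1 -> K) (nxt : 'I_d.+1 -> 'I_d.+1 -> K) :
  injective th -> irreflexive adj -> symmetric adj ->
  (forall S : {set 'I_d.+1}, S != set0 -> S != setT ->
     exists i j, [/\ i \in S, j \notin S & adj i j]) ->
  (forall r c s, r != s -> ~~ adj r s -> adj r c -> adj c s ->
     (forall t, adj r t -> adj t s -> t = c) -> th s = nxt r c) ->
  has_leaf adj -> is_path_graph adj.
Proof.
move=> th_inj adj_irr adj_sym conn next [v leaf].
have build k : (k <= d)%N -> exists2 x, x 0%N = v & path_prefix adj k x.
  elim: k => [_|k IH kd].
    exists (fun=> v) => //; split=> // a b; rewrite !inE !leqn0.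
    by move=> /eqP-> /eqP->.
  have [x x0 [x_inj x_adj x_out]] := IH (ltnW kd).
  pose S := [set x (val a) | a : 'I_k.+1].
  have xS a : (a <= k)%N -> x a \in S.
    by rewrite -ltnS => ak; apply/imsetP; exists (Ordinal ak).
  have [||i [j [/imsetP[[a ak] _ ->] jS /= xaj]]] := conn S.
  - by apply/set0Pn; exists (x 0%N); apply: xS.
  - apply/eqP => ST; have := leq_imset_card (fun a : 'I_k.+1 => x (val a)) predT.
    by rewrite -/S ST cardsT !card_ord; lia.
  have {a ak xaj} xkj : adj (x k) j.
    move: ak; rewrite ltnS leq_eqVlt => /orP[/eqP ak|ak]; first by rewrite -ak.
    by case: (x_out a j ak xaj) jS => [->|[_ ->]]; rewrite xS //; lia.
  have xkE w : adj (x k) w -> w = j \/ (0 < k)%N /\ w = x k.-1.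
    case: (posnP k) => [k0|k0] xkw; first left.
      rewrite k0 x0 in xkj xkw.
      by apply: (card_le1_eqP leaf); rewrite inE.
    case: (boolP (w \in S)) => [/imsetP[[a ak] _ /= wa]|wS]; [right|left].
      split=> //; move: ak xkw; rewrite wa ltnS leq_eqVlt => /orP[/eqP->|ak].
        by rewrite adj_irr.
      rewrite adj_sym => /(x_out a _ ak)[|[a0]] /x_inj; rewrite !inE => ka.
        by rewrite ka //; lia.
      by move: ka => /(_ _ _); lia.
    have k1 : x k.-1.+1 = x k by rewrite prednK.
    have k1k : (k.-1 < k)%N by lia.
    (* [x k] is the only common neighbour of [x k.-1] and [s]: the other possible neighbour of
       [x k.-1] is [x k.-2], whose neighbours all lie in [S]. *)
    have nx s : s \notin S -> adj (x k) s -> th s = nxt (x k.-1) (x k).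
      move=> sS xks; apply: next => //.
      - by apply: contraNneq sS => <-; apply: xS; lia.
      - apply/negP => /(x_out _ _ k1k); rewrite k1 => -[sk|[_ sk]].
          by move: sS; rewrite sk xS.
        by move: sS; rewrite sk xS //; lia.
      - by rewrite -k1; apply: x_adj.
      move=> t /(x_out _ _ k1k); rewrite k1 => -[//|[k2 ->]] ts.
      have k3 : (k.-1.-1 < k)%N by lia.
      by case: (x_out _ _ k3 ts) sS => [->|[_ ->]]; rewrite xS //; lia.
    by apply: th_inj; rewrite !nx.
  pose x' a := if (a <= k)%N then x a else j.
  exists x'; first by rewrite /x'.
  split.
  - move=> a b; rewrite !inE /x'; case: (leqP a k) => ak; case: (leqP b k) => bk a1 b1.
    + by move=> /x_inj; apply; rewrite inE.
    + by move=> xj; move: jS; rewrite -xj xS.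
    + by move=> xj; move: jS; rewrite xj xS.
    + lia.
  - move=> a; rewrite ltnS leq_eqVlt /x' => /orP[/eqP->|ak].
      by rewrite leqnn ltnn.
    by rewrite ak (ltnW ak); apply: x_adj.
  - move=> a w; rewrite ltnS leq_eqVlt /x' => /orP[/eqP->|ak].
      by rewrite leqnn ltnn leq_pred; apply: xkE.
    by rewrite ak (ltnW ak) (leq_trans (leq_pred a) (ltnW ak)); apply: x_out.
have [x _ [x_inj x_adj x_out]] := build d (leqnn d).
(* At k = d the prefix has as many vertices as the graph, so it exhausts them. *)
have xi : injective (fun i : 'I_d.+1 => x i).
  move=> a b /x_inj H; apply: val_inj; apply: H; rewrite inE -ltnS; exact: ltn_ord.
exists (fun i => x i); split; first exact: injF_bij.
have half (a b : 'I_d.+1) : (a < b)%N -> adj (x a) (x b) = (a.+1 == b).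
  move=> ab; have bd : (b <= d)%N by rewrite -ltnS.
  have ad : (a < d)%N by lia.
  apply/idP/eqP => [/(x_out _ _ ad)[|[a0]] /x_inj|<-]; last exact: x_adj.
    by rewrite !inE => ->.
  by rewrite !inE => /(_ _ _); lia.
move=> a b; case: (ltngtP a b) => ab.
- by rewrite half // (_ : (b.+1 == a) = false) ?orbF //; lia.
- by rewrite adj_sym half // (_ : (a.+1 == b) = false) //; lia.
- by rewrite ab adj_irr (_ : (b.+1 == b :> nat) = false) //; lia.
Qed.

Lemma askey_wilson_next (F : fieldType) (d : nat) (M B Y : 'M[F]_d.+1)
    (th ths : 'I_d.+1 -> F) (beta gs gamma omega etas : F) :
  (0 < d)%N -> irred_tridiag B -> Y \in unitmx ->
  M *m Y = Y *m dmx ths -> dmx th *m Y = Y *m B ->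
  (forall i : nat, (1 <= i)%N -> (i <= d.-1)%N ->
     gs = ths (inord i.-1) - beta * ths (inord i) + ths (inord i.+1)) ->
  (forall i : 'I_d.+1,
     B i i * (ths i - ths_prev ths beta gs i) * (ths i - ths_next ths beta gs i)
     = gamma * ths i ^+ 2 + omega * ths i + etas) ->
  forall r c s : 'I_d.+1, r != s -> M r s = 0 -> M r c != 0 -> M c s != 0 ->
    (forall t, M r t != 0 -> M t s != 0 -> t = c) ->
    th s = gamma + beta * th c - th r.
Proof.
move=> d0 Bt Yu MY LY rec aE r c s rs Mrs Mrc Mcs only_c.
(* The biquadratic at the first edge; the recurrence makes its value the same at every edge. *)
pose rho := ths (inord 0) ^+ 2 - beta * ths (inord 0) * ths (inord 1)
  + ths (inord 1) ^+ 2 - gs * (ths (inord 0) + ths (inord 1)).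
have edge i : (i < d)%N -> ths (inord i) ^+ 2
      - beta * ths (inord i) * ths (inord i.+1) + ths (inord i.+1) ^+ 2
      - gs * (ths (inord i) + ths (inord i.+1)) = rho.
  elim: i => [//|i IH id_]; rewrite -IH; last lia.
  have /= := rec i.+1 isT; move=> /(_ _)->; [ring|lia].
have G := aw_poly_tridiag d0 Bt rec edge.
have MLE : aw_poly M (dmx th) beta gs rho = gamma *: (M *m M) + omega *: M + etas%:M.
  apply: (can_inj (mulmxK Yu)); rewrite (aw_poly_conj _ _ _ MY LY) G.
  have -> : dmx (fun i => B i i * (ths i - ths_prev ths beta gs i)
       * (ths i - ths_next ths beta gs i)) =
     gamma *: (dmx ths *m dmx ths) + omega *: dmx ths + etas%:M.
    have addE (C D : 'M[F]_d.+1) i k : (C + D) i k = C i k + D i k by rewrite mxE.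
    have scaleE a (C : 'M[F]_d.+1) i k : (a *: C) i k = a * C i k by rewrite mxE.
    apply/matrixP=> i j; rewrite !(addE, scaleE) mul_dmx !dmxE mxE aE.
    by case: eqP => [->|_]; rewrite ?mulr1n ?mulr0n; ring.
  rewrite !(mulmxDl, mulmxDr) -!scalemxAl -!scalemxAr -(mulmxA M) MY !mulmxA MY.
  by rewrite scalar_mxC.
have sumE (f : 'I_d.+1 -> F) : \sum_t M r t * f t * M t s = M r c * f c * M c s.
  rewrite (bigD1 c) //= big1 ?addr0 // => t tc.
  case: (eqVneq (M r t) 0) => [->|rt]; first by rewrite !mul0r.
  case: (eqVneq (M t s) 0) => [->|ts]; first by rewrite mulr0.
  by rewrite (only_c t rt ts) eqxx in tc.
have MM : (M *m M) r s = M r c * M c s.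
  rewrite mxE -[M r c]mulr1 -(sumE (fun=> 1)); apply: eq_bigr => t _; by rewrite mulr1.
have MLM : (M *m dmx th *m M) r s = M r c * th c * M c s.
  rewrite mxE -sumE; apply: eq_bigr => t _; by rewrite mul_mx_dmx.
have addE (C D : 'M[F]_d.+1) i k : (C + D) i k = C i k + D i k by rewrite mxE.
have oppE (C : 'M[F]_d.+1) i k : (- C) i k = - C i k by rewrite mxE.
have scaleE a (C : 'M[F]_d.+1) i k : (a *: C) i k = a * C i k by rewrite mxE.
have := congr1 (fun C : 'M_d.+1 => C r s) MLE.
(* At (r, s) the terms linear in [M] and the scalar term vanish, and every remaining term has the
   factor [M r c * M c s]. *)
rewrite /aw_poly !(addE, oppE, scaleE) MLM !(mul_mx_dmx, mul_dmx) MM Mrs dmxE mxE.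
rewrite (negbTE rs) !mulr0n => E.
apply: (mulfI Mrc); apply: (mulIf Mcs); apply/eqP; rewrite -subr_eq0.
move/eqP: E; rewrite -subr_eq0 => /eqP E.
apply/eqP; rewrite -[RHS]E; ring.
Qed.

(** * Frames of idempotents and the passage to matrices *)

Lemma delta_mx_dmx (F : fieldType) (n : nat) (j : 'I_n) :
  delta_mx j j = dmx (fun i => (i == j)%:R) :> 'M[F]_n.
Proof.
apply/matrixP=> a b; rewrite mxE dmxE.
by case: (eqVneq a b) => [->|ab]; [rewrite andbb|case: eqP => // <-; rewrite eq_sym (negbTE ab)].
Qed.

(** In row-vector convention, [P j] fixes [u j] and kills the other [u i]. Applying [P j] to a
    linear relation among the rows isolates its coefficient at [j], so the rows form a basis. *)
Lemma diag_frame (F : fieldType) (n : nat) (P : 'I_n -> 'M[F]_n) (u : 'I_n -> 'rV[F]_n) :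
  (forall i, u i != 0) -> (forall i j, u i *m P j = if i == j then u i else 0) ->
  let U := \matrix_i u i in
  U \in unitmx /\ forall j, P j = invmx U *m delta_mx j j *m U.
Proof.
move=> u0 uP U.
have UP j : U *m P j = delta_mx j j *m U.
  apply/matrixP=> i b; rewrite delta_mx_dmx mul_dmx.
  have := congr1 (fun x : 'rV_n => x 0 b) (uP i j); rewrite -[u i in LHS](rowK u) -row_mul mxE.
  by move=> ->; case: eqP; rewrite !mxE ?mul1r ?mul0r.
have Uu : U \in unitmx.
  rewrite -row_free_unit -kermx_eq0; apply/eqP/matrixP=> a j; rewrite [RHS]mxE.
  have [b ub] : exists b, U j b != 0.
    by have /rV0Pn[b ub] := u0 j; exists b; rewrite mxE.
  have := congr1 (fun C : 'M_n => (C *m P j) a b) (mulmx_ker U).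
  rewrite mul0mx [RHS]mxE -mulmxA UP delta_mx_dmx mulmxA mxE (bigD1 j) //= big1 => [|t tj].
    by rewrite addr0 mul_mx_dmx eqxx mulr1 => /eqP; rewrite mulf_eq0 (negbTE ub) orbF => /eqP.
  by rewrite mul_mx_dmx (negbTE tj) mulr0 mul0r.
by split=> // j; rewrite -mulmxA -UP mulKmx.
Qed.

(** Each factor acts on the eigenvector as a scalar; the product is a Lagrange basis polynomial
    evaluated at [th i]. *)
Lemma prim_idem_eigenvector (F : fieldType) (d : nat) (A : 'M[F]_d.+1)
    (th : 'I_d.+1 -> F) (x : 'rV[F]_d.+1) i j :
  injective th -> x *m A = th i *: x ->
  x *m prim_idem A th j = if i == j then x else 0.
Proof.
move=> th_inj xA.
have -> : x *m prim_idem A th j =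
    (\prod_(k < d.+1 | k != j) ((th j - th k)^-1 * (th i - th k))) *: x.
  rewrite /prim_idem.
  elim/big_rec2: _ => [|k c C _ IH]; first by rewrite mulmx1 scale1r.
  rewrite -[_ * C]/(_ *m C) mulmxA -scalemxAr mulmxBr xA mul_mx_scalar -scalerBl.
  by rewrite scalerA -scalemxAl IH scalerA.
case: eqVneq => [->|ij].
  rewrite big1 ?scale1r // => k kj; rewrite mulVf // subr_eq0.
  by apply: contra kj => /eqP/th_inj->.
by rewrite (bigD1 i) //= subrr mulr0 mul0r scale0r.
Qed.

Lemma frame_sandwich_eq0 (F : fieldType) (n : nat) (U C : 'M[F]_n) i j : U \in unitmx ->
  ((invmx U *m delta_mx i i *m U) *m C *m (invmx U *m delta_mx j j *m U) == 0) =
  ((U *m C *m invmx U) i j == 0).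
Proof.
move=> Uu; set N := U *m C *m invmx U.
have -> : (invmx U *m delta_mx i i *m U) *m C *m (invmx U *m delta_mx j j *m U) =
  invmx U *m (N i j *: delta_mx i j) *m U.
  have -> : N i j *: delta_mx i j = delta_mx i i *m N *m delta_mx j j.
    apply/matrixP=> a b; rewrite !delta_mx_dmx mul_mx_dmx mul_dmx !mxE.
    case: (eqVneq a i) => [->|]; case: (eqVneq b j) => [->|];
      by rewrite /= ?mulr1 ?mulr0 ?mul0r ?mul1r.
  by rewrite /N !mulmxA.
rewrite -mulmxA -(inj_eq (can_inj (mulKmx Uu))) mulKVmx // mulmx0.
rewrite -(inj_eq (can_inj (mulmxKV Uu))) mulmxK // mul0mx scaler_eq0.
by rewrite [delta_mx i j == 0](_ : _ = false) ?orbF //; apply/eqP=> /matrixP/(_ i j)/eqP;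
  rewrite !mxE !eqxx oner_eq0.
Qed.

Lemma sum_delta_mx (F : fieldType) (n : nat) (f : 'I_n -> F) :
  \sum_i f i *: delta_mx i i = dmx f.
Proof.
apply/matrixP=> a b; rewrite summxE dmxE (bigD1 b) //= big1 => [|i ib].
  by rewrite !mxE eqxx andbT addr0; case: eqP => _; rewrite ?mulr1 ?mulr0.
by rewrite !mxE [b == i]eq_sym (negbTE ib) andbF mulr0.
Qed.

Lemma mxtrace_delta_mul (F : fieldType) (n : nat) (C : 'M[F]_n) i :
  \tr (delta_mx i i *m C) = C i i.
Proof.
rewrite delta_mx_dmx /mxtrace (bigD1 i) //= big1 => [|j ji]; rewrite mul_dmx.
  by rewrite eqxx mul1r addr0.
by rewrite (negbTE ji) mul0r.
Qed.

(** Reindexing permutes a product of matrices, so the two sides are compared on an eigenbasis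
    instead of factor by factor. *)
Lemma prim_idem_reindex (F : fieldType) (d : nat) (A : 'M[F]_d.+1)
    (th : 'I_d.+1 -> F) (x : 'I_d.+1 -> 'I_d.+1) i :
  injective th -> (forall j, eigenvalue A (th j)) -> bijective x ->
  prim_idem A (th \o x) i = prim_idem A th (x i).
Proof.
move=> th_inj eig [y xy yx].
have /fin_all_exists2[v vA v0] k : exists2 v : 'rV_d.+1, v *m A = th k *: v & v != 0.
  by apply/eigenvalueP.
have [Uu _] := diag_frame v0 (fun i j => prim_idem_eigenvector j th_inj (vA i)).
apply: (can_inj (mulKmx Uu)); apply/row_matrixP => k; rewrite !row_mul rowK.
rewrite (prim_idem_eigenvector _ th_inj (vA k)).
rewrite (@prim_idem_eigenvector _ _ _ (th \o x) _ (y k)) /= ?yx ?vA //.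
  by rewrite -[k == x i](can_eq yx) xy.
by apply: inj_comp => //; exact: can_inj xy.
Qed.


Lemma tridiagonal_setting (F : fieldType) (d : nat)
    (Es : 'I_(d.+1) -> 'M[F]_(d.+1)) (A : 'M[F]_(d.+1)) (th ths : 'I_(d.+1) -> F) :
  (forall i j, Es i *m Es j = (if i == j then Es i else 0)) ->
  (forall i, \rank (Es i) = 1%N) ->
  (forall i j : 'I_(d.+1),
      ((i.+1 < j)%N || (j.+1 < i)%N) -> Es i *m A *m Es j = 0) ->
  (forall i j : 'I_(d.+1),
      ((i.+1 == j)%N || (j.+1 == i)%N) -> Es i *m A *m Es j != 0) ->
  injective th -> (forall i, eigenvalue A (th i)) ->
  exists M B Y : 'M[F]_d.+1,
    [/\ irred_tridiag B /\ Y \in unitmx, M *m Y = Y *m dmx ths, dmx th *m Y = Y *m B,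
        forall i, \tr (Es i *m A) = B i i
      & forall i j, Delta_adj (prim_idem A th) (dual_op Es ths) i j = (i != j) && (M i j != 0)].
Proof.
move=> Eidem Erank A0 An th_inj eig.
have En i : Es i != 0 by rewrite -mxrank_eq0 Erank.
have [] := @diag_frame _ _ Es (fun i => nz_row (Es i)).
- by move=> i; rewrite nz_row_eq0.
- move=> i j; have /submxP[w ->] := nz_row_sub (Es i).
  by rewrite -mulmxA Eidem; case: eqP => // _; rewrite mulmx0.
set U := \matrix_i _ => Uu EU.
have /fin_all_exists2[x xA x0] i : exists2 v : 'rV_d.+1, v *m A = th i *: v & v != 0.
  by apply/eigenvalueP.
have [] := @diag_frame _ _ (prim_idem A th) x x0.
  by move=> i j; exact: prim_idem_eigenvector.
set X := \matrix_i _ => Xu EX.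
have XA : X *m A = dmx th *m X.
  by apply/row_matrixP => i; rewrite row_mul !rowK xA; apply/rowP=> b;
      rewrite [RHS]mxE mul_dmx !mxE.
(* Rows of [U] span the images of the [Es i], rows of [X] are eigenvectors of [A], and [Y] is the
   transition between the two bases. *)
pose B := U *m A *m invmx U; pose Y := X *m invmx U.
have Yu : Y \in unitmx by rewrite unitmx_mul Xu unitmx_inv.
have dualE : dual_op Es ths = invmx U *m dmx ths *m U.
  rewrite -sum_delta_mx mulmx_sumr mulmx_suml; apply: eq_bigr => i _.
  by rewrite EU -scalemxAr -scalemxAl.
pose M := X *m dual_op Es ths *m invmx X.
exists M, B, Y; split.
- split=> //; split=> i j ij; rewrite /B.
    by apply/eqP; rewrite -frame_sandwich_eq0 // -!EU A0.
  by rewrite -frame_sandwich_eq0 // -!EU An.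
- by rewrite /M /Y dualE !mulmxA mulmxKV // mulmxK.
- by rewrite /Y /B !mulmxA mulmxKV // XA.
- by move=> i; rewrite EU -!mulmxA mxtrace_mulC -!mulmxA mxtrace_delta_mul /B -mulmxA.
- by move=> i j; rewrite /Delta_adj !EX frame_sandwich_eq0.
Qed.

(** * The equivalence between paths and the parameter conditions *)

Lemma path_graph_has_leaf (d : nat) (adj : rel 'I_d.+1) :
  is_path_graph adj -> has_leaf adj.
Proof.
move=> [x [[y yx xy] adjE]]; exists (x ord0); apply/card_le1_eqP => a b.
rewrite !inE -[a]xy -[b]xy !adjE !orbF => /eqP ya /eqP yb.
by congr (x _); apply: val_inj; rewrite /= -ya -yb.
Qed.

Unset Implicit Arguments.

Theorem theorem5p1 (F : fieldType) (d : nat) (hd : (1 <= d)%N)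
  (Es : 'I_(d.+1) -> 'M[F]_(d.+1)) (A : 'M[F]_(d.+1))
  (th ths : 'I_(d.+1) -> F)
  (hEs_idem : forall i j : 'I_(d.+1),
      Es i *m Es j = (if i == j then Es i else 0))
  (hEs_rank : forall i : 'I_(d.+1), \rank (Es i) = 1%N)
  (hA_zero : forall i j : 'I_(d.+1),
      ((i.+1 < j)%N || (j.+1 < i)%N) -> Es i *m A *m Es j = 0)
  (hA_nz : forall i j : 'I_(d.+1),
      ((i.+1 == j)%N || (j.+1 == i)%N) -> Es i *m A *m Es j != 0)
  (hth_inj : injective th)
  (hth_eig : forall i : 'I_(d.+1), eigenvalue A (th i)) :
  let E := prim_idem A th in
  let As := dual_op Es ths in
  let a := fun i : 'I_(d.+1) => \tr (Es i *m A) in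
  let adj := Delta_adj E As in
  is_path_graph adj <->
  [/\ has_leaf adj,
      (exists beta gammas : F,
         (forall i : nat, (1 <= i)%N -> (i <= d.-1)%N ->
            gammas = ths (inord i.-1) - beta * ths (inord i) + ths (inord i.+1))
         /\
         exists gamma omega etas : F,
           forall i : 'I_(d.+1),
             a i * (ths i - ths_prev ths beta gammas i)
                 * (ths i - ths_next ths beta gammas i)
             = gamma * ths i ^+ 2 + omega * ths i + etas)
    & forall i : 'I_(d.+1), (1 <= i)%N -> ths i != ths (inord 0)].
Proof.
move=> E As a adj.
have ord0E : inord 0 = ord0 :> 'I_d.+1 by apply: val_inj; rewrite /= inordK.
split=> [path|[leaf [beta [gs [rec [gamma [omega [etas aE]]]]]] ths0]].
  have [x [x_bij adjx]] := path.
  (* The eigenvalues are listed in the order of the path, which makes [M] tridiagonal; [a] and [ths]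
     do not depend on this order. *)
  have thx_inj : injective (th \o x) by apply: inj_comp => //; exact: bij_inj.
  have [M [B [Y [[Bt Yu] MY LY aB adjE]]]] :=
    tridiagonal_setting ths hEs_idem hEs_rank hA_zero hA_nz thx_inj (fun i => hth_eig (x i)).
  have idemE i := prim_idem_reindex i hth_inj hth_eig x_bij.
  have {}adjE i j : (i != j) && (M i j != 0) = (i.+1 == j)%N || (j.+1 == i)%N.
    rewrite -adjE -adjx /adj /Delta_adj /E -!idemE.
    by rewrite (inj_eq (bij_inj x_bij)).
  have Mt : irred_tridiag M.
    split=> i j ij; have := adjE i j; last by rewrite ij => /andP[].
    have -> : i != j by apply: contraTneq ij => ->; lia.
    move=> /= H; apply/eqP/negbNE; rewrite H; lia.
  split; first exact: path_graph_has_leaf.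
    have [beta [gs [rec [gamma [omega [etas aE]]]]]] :=
      qpoly_parameters hd thx_inj Mt Bt Yu MY LY.
    exists beta, gs; split=> //; exists gamma, omega, etas => i.
    by rewrite /a aB aE.
  move=> i i0; rewrite (inj_eq (tridiag_spectrum_inj Mt Yu MY)) ord0E.
  by rewrite -val_eqE /= -lt0n.
have [M [B [Y [[Bt Yu] MY LY aB adjE]]]] :=
  tridiagonal_setting ths hEs_idem hEs_rank hA_zero hA_nz hth_inj hth_eig.
have Msym := dual_support_sym _ _ hth_inj Bt Yu MY LY.
have ths0' i : i != ord0 -> ths i != ths ord0.
  by rewrite -val_eqE /= -lt0n -ord0E; apply: ths0.
have adj_sym : symmetric adj by move=> i j; rewrite /adj !adjE Msym eq_sym.
apply: (path_graph_of_leaf (nxt := fun r c => gamma + beta * th c - th r) hth_inj) => //.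
- by move=> i; rewrite /adj adjE eqxx.
- move=> S S0 ST; case: (boolP [exists i, [exists j, [&& i \in S, j \notin S & adj i j]]]).
    by move=> /existsP[i /existsP[j /and3P[iS jS ij]]]; exists i, j.
  move=> /existsPn none; have [] := dual_connected (S := S) Bt Yu MY LY ths0'.
  + move=> i j iS jS; have := none i; move=> /existsPn/(_ j).
    rewrite iS jS /adj adjE /= (_ : i != j) ?negbK; last first.
      by apply: contraNneq jS => <-.
    by move=> /= /eqP Mij; split=> //; apply/eqP; rewrite Msym Mij.
  + by move=> S0'; rewrite S0' eqxx in S0.
  + by move=> ST'; rewrite ST' eqxx in ST.
- move=> r c s rs; rewrite /adj !adjE rs /= negbK => /eqP Mrs /andP[rc Mrc] /andP[cs Mcs] only_c.
  apply: (askey_wilson_next hd Bt Yu MY LY rec _ rs Mrs Mrc Mcs).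
    by move=> i; rewrite -aB aE.
  (* Diagonal entries of [M] may be nonzero, but [t] equal to [r] or [s] would turn one of the two
     nonzero entries into [M r s], which is 0. *)
  move=> t Mrt Mts; apply: only_c; rewrite adjE ?Mrt ?Mts andbT.
    by apply: contraNneq Mts => <-; rewrite Mrs.
  by apply: contraNneq Mrt => ->; rewrite Mrs.
Qed.
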